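(* Let $\mathsf{M}=\langle X_M, I_M, \mathit{Init}_M, \mathit{Ev}_M\rangle$ be a correct B event system, let $X\subseteq X_M$ be a set of observed variables, and let $X_A$ be the set of abstract variables obtained from $X$ by data-flow dependency only (Proposition 1, see context). Let $\mathsf{A}=\langle X_A, I_A, \mathit{Init}_A, \mathit{Ev}_A\rangle$ be the abstraction of $\mathsf{M}$ with $I_A=T_{X_A}(I_M)$, $\mathit{Init}_A=T_{X_A}(\mathit{Init}_M)$ and, for each event $ev\triangleq S_M$ of $\mathit{Ev}_M$, an event $ev\triangleq T_{X_A}(S_M)$ in $\mathit{Ev}_A$. Then $\mathsf{A}$ is refined by $\mathsf{M}$: writing $\widehat{\cdot}$ for the renaming of every variable $x$ of $\mathsf{A}$ into a fresh copy $\hat x$ and $J\equiv I_M\wedge\bigwedge_{x\in X_A}(x=\hat x)$ for the gluing invariant, (1) $[\mathit{Init}_M]\,\neg[\widehat{\mathit{Init}_A}]\,\neg J$ is valid, and (2) for every event $ev\triangleq S_M$ in $\mathit{Ev}_M$ with corresponding $ev\triangleq S_A$ in $\mathit{Ev}_A$, $\widehat{I_A}\wedge J\Rightarrow[S_M]\,\neg[\widehat{S_A}]\,\neg J$ is valid.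
   Context: Substitutions (B generalized substitutions) are built from: assignment $x:=E$; multiple assignment $x,y:=E,F$ (commutative); $\mathit{skip}$; guarded substitution $P\Rightarrow S$; bounded choice $S_1[]S_2$; local-variable substitution $@z.S$. Weakest preconditions: $[x:=E]P$ is substitution of $E$ for free $x$ in $P$; $[\mathit{skip}]P\Leftrightarrow P$; $[P_1\Rightarrow S]P_2\Leftrightarrow(P_1\Rightarrow[S]P_2)$; $[S_1[]S_2]P\Leftrightarrow[S_1]P\wedge[S_2]P$; $[@z.S]P\Leftrightarrow\forall z.[S]P$ ($z$ not free in $P$). A correct B event system $\langle X, I, \mathit{Init}, \mathit{Ev}\rangle$: $X$ a set of state variables, $I$ an invariant over $X$, $\mathit{Init}$ a substitution with $[\mathit{Init}]I$ valid, $\mathit{Ev}$ a set of events $ev_i\triangleq S_i$ with $I\Rightarrow[S_i]I$ valid. CF: conjunction of disjunctions of elementary predicates $E(Y)\,r\,F(Z)$ (expressions with variable sets $Y,Z$, relational operator $r$) or $\forall z.Q$/$\exists z.Q$ with $Q$ in CF. Invariants and guards are put into CF before transformation. Predicate abstraction: $T_X(E(Y)\,r\,F(Z))=E(Y)\,r\,F(Z)$ if $Y,Z\subseteq X$, else $\mathit{true}$; $T_X(P_1\vee P_2)=T_X(P_1)\vee T_X(P_2)$; $T_X(P_1\wedge P_2)=T_X(P_1)\wedge T_X(P_2)$; $T_X(\alpha z.P)=\alpha z.T_{X\cup\{z\}}(P)$. Substitution abstraction: $T_X(x:=E)=\mathit{skip}$ if $x\notin X$, $x:=E$ if $x\in X$;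 $T_X(\mathit{skip})=\mathit{skip}$; $T_X(x,y:=E,F)$ is $\mathit{skip}$ if $x,y\notin X$, $x:=E$ if only $x\in X$ ($y:=F$ if only $y\in X$), $x,y:=E,F$ if both in $X$; $T_X(P\Rightarrow S)=T_X(P)\Rightarrow T_X(S)$; $T_X(S_1[]S_2)=T_X(S_1)[]T_X(S_2)$; $T_X(@z.S)=@z.T_{X\cup\{z\}}(S)$. Proposition 1 (data-flow dependency): $X_A$ is the least set of state variables containing $X$ such that, for every assignment (or component of a multiple assignment) $x:=E$ occurring in $\mathit{Init}_M$ or in an event of $\mathsf{M}$ with $x\in X_A$, every state variable occurring in $E$ belongs to $X_A$.
   Formalization: Added assumption: Init_M assigns every variable of X_A on each branch, and none of its guards or right-hand sides reads a variable of X_A (as B requires of initialisations); otherwise (1) fails, e.g. for Init_M = skip, where it would require x = x̂ in every state. *)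

(* Defs.v *)
From HB Require Import structures.
From mathcomp Require Import all_boot.
From mathcomp Require Import finmap.

Set Implicit Arguments.
Unset Strict Implicit.
Unset Printing Implicit Defensive.

Local Open Scope fset_scope.

(** Variable names; state variables, local variables and quantified variables
    share this one countable supply. *)
Notation var := nat.

(** Expressions are first-order terms over an arbitrary signature.  An
    expression E(Y) of any set-theoretic shape (including one with its own
    binders, such as a comprehension) is an operator applied to the variables
    of Y; constants are operators without arguments. *)
Inductive term (fs : Type) : Type :=
| Var of var
| App of fs & seq (term fs).

(** Equality is singled out because the gluing invariant needs it; [RSym]
    covers all other relational operators, negated ones included. *)
Inductive relop (rs : Type) : Type :=
| REq
| RSym of rs.

Arguments Var {fs}.
Arguments REq {rs}.

Inductive form (fs rs : Type) : Type :=
| Tru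
| Elem of term fs & relop rs & term fs
| Neg of form fs rs
| And of form fs rs & form fs rs
| Or of form fs rs & form fs rs
| Imp of form fs rs & form fs rs
| All of var & form fs rs
| Ex of var & form fs rs.

Arguments Tru {fs rs}.

(** [MAssign [:: (x, E); (y, F)]] is [x, y := E, F]; any number of components
    is allowed, and [well_formed] requires distinct targets. *)
Inductive gsubst (fs rs : Type) : Type :=
| Assign of var & term fs
| MAssign of seq (var * term fs)
| Skip
| Guard of form fs rs & gsubst fs rs
| Choice of gsubst fs rs & gsubst fs rs
| Local of var & gsubst fs rs.

Arguments Assign {fs rs}.
Arguments MAssign {fs rs}.
Arguments Skip {fs rs}.

Section Syntax.
Variables (fs rs : Type).
Implicit Types (t E F : term fs) (P Q : form fs rs) (S : gsubst fs rs).
Implicit Types (X : {fset var}) (sigma : var -> term fs) (rho : var -> var).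

Fixpoint fvt t : {fset var} :=
  match t with
  | Var x => [fset x]
  | App _ ts => foldr (fun u A => fvt u `|` A) fset0 ts
  end.

Fixpoint fv P : {fset var} :=
  match P with
  | Tru => fset0
  | Elem E _ F => fvt E `|` fvt F
  | Neg Q => fv Q
  | And P1 P2 | Or P1 P2 | Imp P1 P2 => fv P1 `|` fv P2
  | All z Q | Ex z Q => fv Q `\ z
  end.

(** All names, bound ones included. *)
Fixpoint vars P : {fset var} :=
  match P with
  | Tru => fset0
  | Elem E _ F => fvt E `|` fvt F
  | Neg Q => vars Q
  | And P1 P2 | Or P1 P2 | Imp P1 P2 => vars P1 `|` vars P2
  | All z Q | Ex z Q => z |` vars Q
  end.

(** Simultaneous capture-avoiding substitution: [avoid z A] is [z] unless
    keeping that name for the binder would capture a variable of [A]. *)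
Definition avoid (z : var) (A : {fset var}) : var :=
  if z \in A then (\max_(x <- A) x).+1 else z.

Fixpoint tsubst sigma t : term fs :=
  match t with
  | Var x => sigma x
  | App f ts => App f (map (tsubst sigma) ts)
  end.

Definition img_fv sigma (A : {fset var}) : {fset var} :=
  \bigcup_(y <- A) fvt (sigma y).

Fixpoint fsubst sigma P : form fs rs :=
  match P with
  | Tru => Tru
  | Elem E r F => Elem (tsubst sigma E) r (tsubst sigma F)
  | Neg Q => Neg (fsubst sigma Q)
  | And P1 P2 => And (fsubst sigma P1) (fsubst sigma P2)
  | Or P1 P2 => Or (fsubst sigma P1) (fsubst sigma P2)
  | Imp P1 P2 => Imp (fsubst sigma P1) (fsubst sigma P2)
  | All z Q => let z' := avoid z (img_fv sigma (fv Q `\ z)) in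
               All z' (fsubst [eta sigma with z |-> Var z'] Q)
  | Ex z Q => let z' := avoid z (img_fv sigma (fv Q `\ z)) in
              Ex z' (fsubst [eta sigma with z |-> Var z'] Q)
  end.

Definition assign_map (l : seq (var * term fs)) : var -> term fs :=
  foldr (fun a sigma => [eta sigma with a.1 |-> a.2]) Var l.

(** [wp S P] is [[S]P].  The clause for [Local] presupposes that [z] is not
    free in [P]; [well_formed] makes the local variables of a system distinct
    from its state variables, which guarantees this for all uses below. *)
Fixpoint wp S P : form fs rs :=
  match S with
  | Assign x E => fsubst [eta Var with x |-> E] P
  | MAssign l => fsubst (assign_map l) P
  | Skip => P
  | Guard G S1 => Imp G (wp S1 P)
  | Choice S1 S2 => And (wp S1 P) (wp S2 P)
  | Local z S1 => All z (wp S1 P)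
  end.

(** [cf true]: conjunctions of disjunctions of literals; [cf false]:
    disjunctions of literals. *)
Fixpoint cf (conj : bool) P : bool :=
  match P with
  | Elem _ _ _ => true
  | And P1 P2 => [&& conj, cf true P1 & cf true P2]
  | Or P1 P2 => cf false P1 && cf false P2
  | All _ Q | Ex _ Q => cf true Q
  | Tru | Neg _ | Imp _ _ => false
  end.

Definition is_CF P : bool := cf true P.

(** Predicates in CF contain neither [Neg] nor [Imp]; the value chosen on
    these two constructors is irrelevant. *)
Fixpoint absP X P : form fs rs :=
  match P with
  | Elem E _ F => if (fvt E `<=` X) && (fvt F `<=` X) then P else Tru
  | And P1 P2 => And (absP X P1) (absP X P2)
  | Or P1 P2 => Or (absP X P1) (absP X P2)
  | All z Q => All z (absP (z |` X) Q)
  | Ex z Q => Ex z (absP (z |` X) Q)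
  | Tru | Neg _ | Imp _ _ => Tru
  end.

Fixpoint absS X S : gsubst fs rs :=
  match S with
  | Assign x E => if x \in X then Assign x E else Skip
  | MAssign l => match [seq a <- l | a.1 \in X] with
                 | [::] => Skip
                 | [:: a] => Assign a.1 a.2
                 | l' => MAssign l'
                 end
  | Skip => Skip
  | Guard G S1 => Guard (absP X G) (absS X S1)
  | Choice S1 S2 => Choice (absS X S1) (absS X S2)
  | Local z S1 => Local z (absS (z |` X) S1)
  end.

(** Renaming of all names, bound ones included; [rho] is only used when it is
    injective on the names of the renamed object. *)
Fixpoint trename rho t : term fs :=
  match t with
  | Var x => Var (rho x)
  | App f ts => App f (map (trename rho) ts)
  end.

Fixpoint frename rho P : form fs rs :=
  match P with
  | Tru => Tru
  | Elem E r F => Elem (trename rho E) r (trename rho F)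
  | Neg Q => Neg (frename rho Q)
  | And P1 P2 => And (frename rho P1) (frename rho P2)
  | Or P1 P2 => Or (frename rho P1) (frename rho P2)
  | Imp P1 P2 => Imp (frename rho P1) (frename rho P2)
  | All z Q => All (rho z) (frename rho Q)
  | Ex z Q => Ex (rho z) (frename rho Q)
  end.

Fixpoint srename rho S : gsubst fs rs :=
  match S with
  | Assign x E => Assign (rho x) (trename rho E)
  | MAssign l => MAssign [seq (rho a.1, trename rho a.2) | a <- l]
  | Skip => Skip
  | Guard G S1 => Guard (frename rho G) (srename rho S1)
  | Choice S1 S2 => Choice (srename rho S1) (srename rho S2)
  | Local z S1 => Local (rho z) (srename rho S1)
  end.

(** The assignments and components of multiple assignments occurring in [S]. *)
Fixpoint assignments S : seq (var * term fs) :=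
  match S with
  | Assign x E => [:: (x, E)]
  | MAssign l => l
  | Skip => [::]
  | Guard _ S1 | Local _ S1 => assignments S1
  | Choice S1 S2 => assignments S1 ++ assignments S2
  end.

(** [y] occurs in the right-hand side of some assignment to [x] in [S]. *)
Definition flows S (x y : var) : bool :=
  has (fun a => (a.1 == x) && (y \in fvt a.2)) (assignments S).

Fixpoint guards S : seq (form fs rs) :=
  match S with
  | Assign _ _ | MAssign _ | Skip => [::]
  | Guard G S1 => G :: guards S1
  | Choice S1 S2 => guards S1 ++ guards S2
  | Local _ S1 => guards S1
  end.

Fixpoint locals S : {fset var} :=
  match S with
  | Assign _ _ | MAssign _ | Skip => fset0
  | Guard _ S1 => locals S1
  | Choice S1 S2 => locals S1 `|` locals S2
  | Local z S1 => z |` locals S1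
  end.

Definition reads_of (l : seq (var * term fs)) : {fset var} :=
  foldr (fun a A => fvt a.2 `|` A) fset0 l.

Definition targets (l : seq (var * term fs)) : {fset var} :=
  [fset x in unzip1 l].

(** Variables, other than local ones, read by a guard or a right-hand side. *)
Fixpoint sreads S : {fset var} :=
  match S with
  | Assign _ E => fvt E
  | MAssign l => reads_of l
  | Skip => fset0
  | Guard G S1 => fv G `|` sreads S1
  | Choice S1 S2 => sreads S1 `|` sreads S2
  | Local z S1 => sreads S1 `\ z
  end.

(** Variables, other than local ones, that may be assigned. *)
Fixpoint swrites S : {fset var} :=
  match S with
  | Assign x _ => [fset x]
  | MAssign l => targets l
  | Skip => fset0
  | Guard _ S1 => swrites S1
  | Choice S1 S2 => swrites S1 `|` swrites S2
  | Local z S1 => swrites S1 `\ z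
  end.

(** Variables, other than local ones, assigned on every branch. *)
Fixpoint must_write S : {fset var} :=
  match S with
  | Assign x _ => [fset x]
  | MAssign l => targets l
  | Skip => fset0
  | Guard _ S1 => must_write S1
  | Choice S1 S2 => must_write S1 `&` must_write S2
  | Local z S1 => must_write S1 `\ z
  end.

(** In B an initialisation gives a value to every state variable without
    consulting the values held before.  [initialises X S] is this condition
    restricted to the variables in [X].  Without it the initialisation
    obligation of [refined_by] fails: for [Skip] it would require [x] and its
    copy to be equal in every state. *)
Definition initialises X S : bool :=
  [disjoint sreads S & X]%fset && (X `<=` must_write S).

Fixpoint distinct_targets S : bool :=
  match S with
  | Assign _ _ | Skip => true
  | MAssign l => uniq (unzip1 l)
  | Guard _ S1 | Local _ S1 => distinct_targets S1
  | Choice S1 S2 => distinct_targets S1 && distinct_targets S2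
  end.

(** All names, bound ones included. *)
Fixpoint svars S : {fset var} :=
  match S with
  | Assign x E => x |` fvt E
  | MAssign l => targets l `|` reads_of l
  | Skip => fset0
  | Guard G S1 => vars G `|` svars S1
  | Choice S1 S2 => svars S1 `|` svars S2
  | Local z S1 => z |` svars S1
  end.

(** [S] is a substitution over the state variables [X]. *)
Definition well_formed X S : bool :=
  [&& sreads S `<=` X, swrites S `<=` X, [disjoint locals S & X]%fset,
      distinct_targets S & all is_CF (guards S)].

End Syntax.

(** [D] is the universe of values. *)
Record interp (fs rs D : Type) := Interp {
  fun_of : fs -> seq D -> D;
  rel_of : rs -> D -> D -> Prop }.

Section Semantics.
Variables (fs rs D : Type) (In : interp fs rs D).
Implicit Types (s : var -> D).

Fixpoint evalt s (t : term fs) : D :=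
  match t with
  | Var x => s x
  | App f ts => fun_of In f (map (evalt s) ts)
  end.

Definition eval_rel (r : relop rs) : D -> D -> Prop :=
  match r with
  | REq => fun a b => a = b
  | RSym q => rel_of In q
  end.

Fixpoint sat s (P : form fs rs) : Prop :=
  match P with
  | Tru => True
  | Elem E r F => eval_rel r (evalt s E) (evalt s F)
  | Neg Q => ~ sat s Q
  | And P1 P2 => sat s P1 /\ sat s P2
  | Or P1 P2 => sat s P1 \/ sat s P2
  | Imp P1 P2 => sat s P1 -> sat s P2
  | All z Q => forall d : D, sat [eta s with z |-> d] Q
  | Ex z Q => exists d : D, sat [eta s with z |-> d] Q
  end.

Definition valid (P : form fs rs) : Prop := forall s, sat s P.

End Semantics.

(** [N] is the finite set of event names. *)
Record system (fs rs : Type) (N : finType) := System {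
  states : {fset var};
  inv : form fs rs;
  init : gsubst fs rs;
  event : N -> gsubst fs rs }.

Section Systems.
Variables (fs rs : Type) (N : finType).
Implicit Types (M A : system fs rs N) (X : {fset var}).

Definition well_formed_system M : Prop :=
  [/\ fv (inv M) `<=` states M, is_CF (inv M), well_formed (states M) (init M)
    & forall e : N, well_formed (states M) (event M e)].

Definition correct (D : Type) (In : interp fs rs D) M : Prop :=
  [/\ well_formed_system M,
      valid In (wp (init M) (inv M))
    & forall e : N, valid In (Imp (inv M) (wp (event M e) (inv M)))].

Definition names M : {fset var} :=
  states M `|` vars (inv M) `|` svars (init M)
    `|` \bigcup_(e <- enum N) svars (event M e).

Definition flow_closed M X : Prop :=
  forall x y : var, x \in X -> y \in states M ->
    flows (init M) x y \/ (exists e : N, flows (event M e) x y) -> y \in X.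

Definition is_abstract_vars M X XA : Prop :=
  [/\ X `<=` XA, XA `<=` states M, flow_closed M XA
    & forall Y : {fset var}, X `<=` Y -> Y `<=` states M ->
        flow_closed M Y -> XA `<=` Y].

Definition abstraction XA M : system fs rs N :=
  System XA (absP XA (inv M)) (absS XA (init M))
    (fun e => absS XA (event M e)).

Definition fresh_copy (hat : var -> var) M : Prop :=
  {in names M &, injective hat} /\ {in names M, forall x, hat x \notin names M}.

Definition gluing (hat : var -> var) A M : form fs rs :=
  And (inv M)
      (\big[@And fs rs/Tru]_(x <- states A) Elem (Var x) REq (Var (hat x))).

Definition refined_by (D : Type) (In : interp fs rs D) (hat : var -> var) A M
    : Prop :=
  let J := gluing hat A M in
  valid In (wp (init M) (Neg (wp (srename hat (init A)) (Neg J))))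
  /\ forall e : N,
       valid In (Imp (And (frename hat (inv A)) J)
                   (wp (event M e)
                      (Neg (wp (srename hat (event A e)) (Neg J))))).

End Systems.

(* Main.v *)
(** A substitution is read as a relation between states, under which [[S]P]
    holds exactly when [P] holds after every execution of [S].  Then
    [[S_M] ~ [S_A] ~ J] asks that every execution of [S_M] be matched by one of
    the renamed [S_A] ending in [J].  The abstract system imitates the concrete
    one: it takes the same branches and gives local variables the same values.
    Guards of [S_A] hold whenever those of [S_M] do, as they are weakened;
    and an assignment to a variable of [XA] reads only [XA] and the
    local variables in scope, on which both systems agree.  Since nothing is
    executed after an assignment, the assignments to local variables, which
    need not be closed under data flow, do no harm. *)

Require Import Defs.
From mathcomp Require Import all_boot.
From mathcomp Require Import finmap.

Local Open Scope fset_scope.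

(** Arguments of [App] sit in a list; the fold hands the hypothesis to each of them and unfolds in
    step with the list inductions that use it. *)
Lemma term_nested_ind (fs : Type) (T : term fs -> Prop) :
  (forall x, T (Var x)) ->
  (forall f ts, foldr (fun t A => T t /\ A) True ts -> T (App f ts)) ->
  forall t, T t.
Proof.
move=> HV HA; fix IH 1 => -[x|f ts]; first exact: HV.
by apply: HA; elim: ts => //= t ts IHts; split.
Qed.

Lemma fv_sub_vars {fs rs : Type} (P : form fs rs) : fv P `<=` vars P.
Proof.
elim: P => //= [P IHP Q IHQ|P IHP Q IHQ|P IHP Q IHQ|z Q IH|z Q IH];
  by [apply: fsetUSS|
      apply: fsubset_trans (fsubsetDl _ _) (fsubset_trans IH (fsubsetUr _ _))].
Qed.

(** * Evaluation, satisfaction and capture-avoiding substitution *)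

Section Semantics.
Context {fs rs D : Type} (In : interp fs rs D).
Implicit Types (s t : var -> D) (E : term fs) (P : form fs rs).
Implicit Types (S : gsubst fs rs).

Lemma evalt_ext {s s'} E : {in fvt E, s =1 s'} -> evalt In s E = evalt In s' E.
Proof.
elim/term_nested_ind: E => [x /= -> //|f ts IH /= H]; first by rewrite inE.
congr (fun_of In f _); elim: ts IH H => //= t ts IHts [IHt IH] H.
congr cons; first by apply: IHt => x xt; apply: H; rewrite inE xt.
by apply: IHts => // x xts; apply: H; rewrite inE xts orbT.
Qed.

Lemma evalt_tsubst s (sigma : var -> term fs) E :
  evalt In s (tsubst sigma E) = evalt In (fun x => evalt In s (sigma x)) E.
Proof.
elim/term_nested_ind: E => [//|f ts IH /=].
congr (fun_of In f _).
by elim: ts IH => //= t ts IHts [-> /IHts ->].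
Qed.

Lemma evalt_trename s (rho : var -> var) E :
  evalt In s (trename rho E) = evalt In (fun x => s (rho x)) E.
Proof.
elim/term_nested_ind: E => [//|f ts IH /=].
congr (fun_of In f _).
by elim: ts IH => //= t ts IHts [-> /IHts ->].
Qed.

Lemma forall_in_fsetU {A B : {fset var}} {T : var -> Prop} :
  {in A `|` B, forall x, T x} -> {in A, forall x, T x} /\ {in B, forall x, T x}.
Proof. by move=> H; split=> x xA; apply: H; rewrite inE xA ?orbT. Qed.

Lemma sat_ext {s s'} P : {in fv P, s =1 s'} -> sat In s P <-> sat In s' P.
Proof.
elim: P s s' => [|E r F|Q IH|P IHP Q IHQ|P IHP Q IHQ|P IHP Q IHQ|z Q IH|z Q IH]
  s s' /= H //.
- rewrite (@evalt_ext s s' E) ?(@evalt_ext s s' F) // => x xP;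
    by apply: H; rewrite inE xP ?orbT.
- by have := IH _ _ H; tauto.
- have [HP HQ] := forall_in_fsetU H; have := IHP _ _ HP; have := IHQ _ _ HQ; tauto.
- have [HP HQ] := forall_in_fsetU H; have := IHP _ _ HP; have := IHQ _ _ HQ; tauto.
- have [HP HQ] := forall_in_fsetU H; have := IHP _ _ HP; have := IHQ _ _ HQ; tauto.
- have HQ d : sat In [eta s with z |-> d] Q <-> sat In [eta s' with z |-> d] Q.
    apply: IH => x xQ /=; case: eqP => // /eqP xz.
    by apply: H; rewrite !inE xz.
  by split=> HA d; apply/HQ.
- have HQ d : sat In [eta s with z |-> d] Q <-> sat In [eta s' with z |-> d] Q.
    apply: IH => x xQ /=; case: eqP => // /eqP xz.
    by apply: H; rewrite !inE xz.
  by split=> -[d Hd]; exists d; apply/HQ.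
Qed.

Lemma avoid_notin z (A : {fset var}) : avoid z A \notin A.
Proof.
rewrite /avoid; case: ifPn => // _; apply/negP => mA.
by have := @leq_bigmax_seq _ (enum_fset A) predT id _ mA isT; rewrite ltnn.
Qed.

(** The new binder is fresh for [sigma x] whenever [x] in [A] differs from [z], so updating it
    disturbs none of these values. *)
Lemma evalt_avoid s (sigma : var -> term fs) z d (A : {fset var}) :
  let z' := avoid z (img_fv sigma (A `\ z)) in
  {in A, (fun x => evalt In [eta s with z' |-> d]
                     ([eta sigma with z |-> Var z'] x))
      =1 [eta fun x => evalt In s (sigma x) with z |-> d]}.
Proof.
move=> z' x xA /=; case: eqP => [_|/eqP xz] /=; first by rewrite eqxx.
apply: evalt_ext => y yx /=; case: eqP => // yz'.
have /negP[] := avoid_notin z (img_fv sigma (A `\ z)).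
rewrite -/z' -yz'; apply/bigfcupP; exists x => //.
by rewrite andbT !inE xz.
Qed.

Lemma sat_fsubst s (sigma : var -> term fs) P :
  sat In s (fsubst sigma P) <-> sat In (fun x => evalt In s (sigma x)) P.
Proof.
elim: P s sigma => [|E r F|Q IH|P IHP Q IHQ|P IHP Q IHQ|P IHP Q IHQ|z Q IH|z Q IH]
  s sigma //=.
- by rewrite !evalt_tsubst.
- by rewrite IH.
- by rewrite IHP IHQ.
- by rewrite IHP IHQ.
- by rewrite IHP IHQ.
(* The two updated states are only known to agree on the free variables of [Q], hence the detour
   through [sat_ext]. *)
- have HQ d := iff_trans (IH _ _) (sat_ext _ (evalt_avoid s sigma z d (fv Q))).
  by split=> HA d; apply/HQ.
- have HQ d := iff_trans (IH _ _) (sat_ext _ (evalt_avoid s sigma z d (fv Q))).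
  by split=> -[d Hd]; exists d; apply/HQ.
Qed.

(** * Executions as relations between states *)

(** The final state keeps the last value of a local variable instead of
    restoring the outer one; this makes [sat_wp] hold without the proviso that
    local variables are not free in [P]. *)
Fixpoint exec S s s' : Prop :=
  match S with
  | Assign x E => s' = fun y => evalt In s ([eta Var with x |-> E] y)
  | MAssign l => s' = fun y => evalt In s (assign_map l y)
  | Skip => s' = s
  | Guard G S1 => sat In s G /\ exec S1 s s'
  | Defs.Choice S1 S2 => exec S1 s s' \/ exec S2 s s'
  | Local z S1 => exists d, exec S1 [eta s with z |-> d] s'
  end.

Lemma sat_wp S s P :
  sat In s (wp S P) <-> forall s', exec S s s' -> sat In s' P.
Proof.
elim: S s => [x E|l||G S1 IH|S1 IH1 S2 IH2|z S1 IH] s /=.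
- by rewrite sat_fsubst; split=> [H _ ->|]; last exact.
- by rewrite sat_fsubst; split=> [H _ ->|]; last exact.
- by split=> [H _ ->|]; last exact.
- rewrite IH; split=> [H s' [HG]|H HG s' H1]; first exact: H.
  by apply: H.
- rewrite IH1 IH2; split=> [[H1 H2] s' []|H]; [exact: H1|exact: H2|].
  by split=> s' Hs'; apply: H; [left|right].
- split=> [H s' [d Hd]|H d]; first by have /IH := H d; apply.
  by apply/IH => s' Hs'; apply: H; exists d.
Qed.

Lemma assign_map_notin (l : seq (var * term fs)) x :
  x \notin unzip1 l -> assign_map l x = Var x.
Proof.
by elim: l => //= a l IH; rewrite inE negb_or => /andP[/negPf -> /IH].
Qed.

Lemma assign_map_filter (l : seq (var * term fs)) (X : {fset var}) x :
  x \in X -> assign_map [seq a <- l | a.1 \in X] x = assign_map l x.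
Proof.
move=> xX; elim: l => //= a l IH.
case: ifP => /= aX; rewrite IH //; case: eqP => // xa.
by rewrite -xa xX in aX.
Qed.

Lemma targets_filter (l : seq (var * term fs)) (X : {fset var}) :
  targets [seq a <- l | a.1 \in X] `<=` X.
Proof.
apply/fsubsetP => x; rewrite inE; elim: l => //= a l IH.
by case: ifP => //= aX; rewrite inE => /orP[/eqP ->|].
Qed.

(** [absS] collapses short lists to [Skip] or [Assign]; the executions coincide by computation, so
    later arguments need only the list form. *)
Lemma exec_srename_absS_MAssign (X : {fset var}) (rho : var -> var) l s s' :
  exec (srename rho (absS X (MAssign l : gsubst fs rs))) s s' <->
  exec (srename rho (MAssign [seq a <- l | a.1 \in X])) s s'.
Proof. by move=> /=; case: [seq a <- l | _] => [|a [|b l']]. Qed.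

(** Local variables belong to [svars], so the value they keep after [exec] does not break the frame
    property. *)
Lemma exec_frame S s s' x : exec S s s' -> x \notin svars S -> s' x = s x.
Proof.
elim: S s => [y E|l||G S1 IH|S1 IH1 S2 IH2|z S1 IH] s /=.
- by move=> ->; rewrite !inE negb_or => /andP[/negPf ->].
- by move=> ->; rewrite !inE negb_or => /andP[/assign_map_notin ->].
- by move=> ->.
- by case=> _ H; rewrite inE negb_or => /andP[_]; apply: IH.
- case=> H; rewrite inE negb_or => /andP[x1 x2]; first exact: IH1.
  exact: IH2.
- case=> d H; rewrite !inE negb_or => /andP[/negPf xz xS].
  by rewrite (IH _ H xS) /= xz.
Qed.

Lemma sat_gluing (hat : var -> var) (N : finType) (A M : system fs rs N) s :
  sat In s (gluing hat A M) <->
  sat In s (Defs.inv M) /\ {in states A, forall x, s x = s (hat x)}.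
Proof.
rewrite /gluing /=.
suff -> : sat In s (\big[@And fs rs/Tru]_(x <- states A)
                      Elem (Var x) REq (Var (hat x))) <->
          {in states A, forall x, s x = s (hat x)} by [].
have memE : {in states A, forall x, s x = s (hat x)} <->
            {in enum_fset (states A), forall x, s x = s (hat x)} by [].
rewrite memE {memE}; elim: (enum_fset _) => [|y r IH].
  by rewrite big_nil; split.
rewrite big_cons /= IH; split=> [[Hy Hr] x|H].
  by rewrite inE => /predU1P[->|/Hr].
split; first by apply: H; rewrite inE eqxx.
by move=> x xr; apply: H; rewrite inE xr orbT.
Qed.

(** * Simulation of concrete executions by the renamed abstraction *)

Section Simulation.
Context (hat : var -> var) (Nm : {fset var}).
Hypothesis hat_inj : {in Nm &, injective hat}.

Lemma eq_hat x y : x \in Nm -> y \in Nm -> (hat x == hat y) = (x == y).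
Proof. by move=> xN yN; apply: (inj_in_eq hat_inj). Qed.

Lemma agree_update s t z d (R : {fset var}) :
  z \in Nm -> R `<=` Nm -> {in R, forall x, t (hat x) = s x} ->
  {in z |` R, forall x, [eta t with hat z |-> d] (hat x) = [eta s with z |-> d] x}.
Proof.
move=> zN /fsubsetP RN H x; rewrite !inE => /orP[/eqP ->|xR] /=.
  by rewrite !eqxx.
by rewrite eq_hat ?H // RN.
Qed.

(** Carries the condition on read variables under a binder, for quantifiers and local variables
    alike. *)
Lemma agree_update_scope z (R Y A : {fset var}) :
  {in A `\ z, forall x, x \in Y -> x \in R} ->
  {in A, forall x, x \in z |` Y -> x \in z |` R}.
Proof.
move=> H x xA; rewrite !inE; case: eqP => //= /eqP xz xY.
by apply: H => //; rewrite !inE xz.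
Qed.

(** An elementary predicate that survives has all its variables in [Y], hence in [R], where the
    states agree; the others become [Tru]. The remaining connectives are monotone. *)
Lemma sat_absP P s t (R Y : {fset var}) :
  vars P `<=` Nm -> R `<=` Nm ->
  {in R, forall x, t (hat x) = s x} ->
  {in fv P, forall x, x \in Y -> x \in R} ->
  sat In s P -> sat In t (frename hat (absP Y P)).
Proof.
elim: P s t R Y => [|E r F|Q IH|P IHP Q IHQ|P IHP Q IHQ|P IHP Q IHQ|z Q IH|z Q IH]
  s t R Y //=.
- move=> _ _ Hst HR; case: ifP => // /andP[/fsubsetP EY /fsubsetP FY] /=.
  rewrite !evalt_trename.
  rewrite (@evalt_ext _ s E) ?(@evalt_ext _ s F) //.
  + by move=> x xF; apply: Hst; apply: HR; [rewrite inE xF orbT|apply: FY].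
  + by move=> x xE; apply: Hst; apply: HR; [rewrite inE xE|apply: EY].
- rewrite fsubUset => /andP[PN QN] RN Hst HR [HP HQ]; split.
  + by apply: (IHP s t R Y) HP => // x xP; apply: HR; rewrite inE xP.
  + by apply: (IHQ s t R Y) HQ => // x xQ; apply: HR; rewrite inE xQ orbT.
- rewrite fsubUset => /andP[PN QN] RN Hst HR [HP|HQ]; [left|right].
  + by apply: (IHP s t R Y) HP => // x xP; apply: HR; rewrite inE xP.
  + by apply: (IHQ s t R Y) HQ => // x xQ; apply: HR; rewrite inE xQ orbT.
- rewrite fsubUset fsub1set => /andP[zN QN] RN Hst HR HQ d.
  apply: (IH _ _ (z |` R) (z |` Y)) (HQ d) => //; last exact: agree_update_scope HR.
    by rewrite fsubUset fsub1set zN.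
  exact: agree_update.
- rewrite fsubUset fsub1set => /andP[zN QN] RN Hst HR [d HQ]; exists d.
  apply: (IH _ _ (z |` R) (z |` Y)) HQ => //; last exact: agree_update_scope HR.
    by rewrite fsubUset fsub1set zN.
  exact: agree_update.
Qed.

Lemma assign_map_rename (l : seq (var * term fs)) x :
  targets l `<=` Nm -> x \in Nm ->
  assign_map [seq (hat a.1, trename hat a.2) | a <- l] (hat x) =
  trename hat (assign_map l x).
Proof.
move=> /fsubsetP lN xN; elim: l lN => //= a l IH lN.
rewrite eq_hat //; last by apply: lN; rewrite !inE eqxx.
case: eqP => // _; apply: IH => y yl; apply: lN.
by move: yl; rewrite !inE => ->; rewrite orbT.
Qed.

Lemma assign_map_rename_notin (l : seq (var * term fs)) y :
  targets l `<=` Nm -> {in Nm, forall x, y != hat x} ->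
  assign_map [seq (hat a.1, trename hat a.2) | a <- l] y = Var y.
Proof.
move=> /fsubsetP lN yN; elim: l lN => //= a l IH lN.
rewrite (negPf (yN _ _)); last by apply: lN; rewrite !inE eqxx.
by apply: IH => x xl; apply: lN; move: xl; rewrite !inE => ->; rewrite orbT.
Qed.

Context (St XA : {fset var}).

(** If [x] is a target, each variable read for it lies in [Y], or is a state variable which [flow]
    puts into [XA], hence into [Y]; being read, it is then in [R]. Otherwise [x] itself is in
    [R]. *)
Lemma assigned_agree (l : seq (var * term fs)) s t (R Y : {fset var}) x :
  XA `<=` Y -> {in R, forall x, t (hat x) = s x} ->
  {in reads_of l, forall x, x \in Y -> x \in R} ->
  reads_of l `<=` Y `|` St ->
  (forall y, has (fun a => (a.1 == x) && (y \in fvt a.2)) l ->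
     y \in St -> y \in XA) ->
  x \in R `|` targets l ->
  evalt In t (trename hat (assign_map l x)) = evalt In s (assign_map l x).
Proof.
move=> /fsubsetP XAY Hst HR /fsubsetP lY flow.
rewrite evalt_trename => xRl; apply: evalt_ext => y.
elim: l HR lY flow xRl => [|a l IH] /= HR lY flow.
  by rewrite !inE orbF => xR /eqP ->; apply: Hst.
case: eqP => [xa|/eqP xa] xRl ya.
  have ya' : y \in fvt a.2 `|` reads_of l by rewrite inE ya.
  apply: Hst; apply: HR => //; have:= lY _ ya'; rewrite inE => /orP[//|ySt].
  by apply/XAY/flow; rewrite // xa eqxx ya.
apply: IH ya.
- by move=> z zl; apply: HR; rewrite inE zl orbT.
- by move=> z zl; apply: lY; rewrite inE zl orbT.
- by move=> z zl; apply: flow; rewrite zl orbT.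
- by move: xRl; rewrite !inE (negPf xa).
Qed.

(** The last clause confines changes to hatted copies, so that the concrete part of the state
    survives the abstract run. *)
Lemma exec_absS_MAssign l s s' t (R Y : {fset var}) :
  targets l `<=` Nm -> R `<=` Nm -> XA `<=` Y -> Y `<=` Nm ->
  {in R, forall x, t (hat x) = s x} ->
  {in reads_of l, forall x, x \in Y -> x \in R} ->
  reads_of l `<=` Y `|` St ->
  (forall x y, x \in XA -> flows (MAssign l : gsubst fs rs) x y ->
     y \in St -> y \in XA) ->
  exec (MAssign l) s s' ->
  exists t', [/\ exec (srename hat (absS Y (MAssign l))) t t',
    {in XA, forall x, x \in R `|` targets l -> t' (hat x) = s' x} &
    forall y, {in Nm, forall x, y != hat x} -> t' y = t y].
Proof.
move=> lN RN XAY YN Hst HR lY flow /= ->.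
exists (fun y => evalt In t (assign_map
  [seq (hat a.1, trename hat a.2) | a <- [seq a <- l | a.1 \in Y]] y)).
have lYN : targets [seq a <- l | a.1 \in Y] `<=` Nm.
  by apply: fsubset_trans (targets_filter l Y) YN.
split; first exact/exec_srename_absS_MAssign.
- move=> x xXA xRl; have xY := fsubsetP XAY _ xXA.
  rewrite assign_map_rename ?(fsubsetP YN) // assign_map_filter //.
  by apply: (assigned_agree l s t R Y) xRl => // y; apply: flow.
- by move=> y yN; rewrite assign_map_rename_notin.
Qed.

(** [Y] is [XA] with the local variables in scope, [R] the part of [Y] on which
    the two states are known to agree beforehand: all of it for an event, only
    the local variables for an initialisation. *)
Lemma exec_absS S s s' t (R Y : {fset var}) :
  svars S `<=` Nm -> R `<=` Nm -> XA `<=` Y -> Y `<=` Nm ->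
  {in R, forall x, t (hat x) = s x} ->
  {in sreads S, forall x, x \in Y -> x \in R} ->
  sreads S `<=` Y `|` St ->
  (forall x y, x \in XA -> flows S x y -> y \in St -> y \in XA) ->
  exec S s s' ->
  exists t', [/\ exec (srename hat (absS Y S)) t t',
    {in XA, forall x, x \in R `|` must_write S -> t' (hat x) = s' x} &
    forall y, {in Nm, forall x, y != hat x} -> t' y = t y].
Proof.
elim: S s t R Y => [x E|l||G S1 IH|S1 IH1 S2 IH2|z S1 IH] s t R Y.
- rewrite /= fsubUset => /andP[xN _] RN XAY YN Hst HR EY flow Hs'.
  (* A single assignment is a multiple one with one component. *)
  have [|//|//|//|//|||//|//|t' [Ht' H1 H2]] :=
    @exec_absS_MAssign [:: (x, E)] s s' t R Y.
  + by apply/fsubsetP => y; rewrite !inE orbF => /eqP ->; rewrite -fsub1set.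
  + by rewrite /= fsetU0.
  + by rewrite /= fsetU0.
  exists t'; split=> //.
    by move: Ht' => /=; case: ifP.
  by move=> y yXA yRx; apply: H1 => //; move: yRx; rewrite !inE orbF.
- rewrite /= fsubUset => /andP[lN _] RN XAY YN Hst HR lY flow Hs'.
  exact: exec_absS_MAssign Hs'.
- move=> _ RN XAY YN Hst _ _ _ /= ->; exists t; split=> // x _.
  by rewrite fsetU0; apply: Hst.
- rewrite /= !fsubUset => /andP[GN SN] RN XAY YN Hst /forall_in_fsetU[HRG HRS]
    /andP[GY SY] flow [HG Hs'].
  have [t' [Ht' H1 H2]] := IH s t R Y SN RN XAY YN Hst HRS SY flow Hs'.
  by exists t'; split=> //; split=> //; exact: (sat_absP _ _ _ _ _ GN RN Hst HRG HG).
- rewrite /= !fsubUset => /andP[SN1 SN2] RN XAY YN Hst /forall_in_fsetU[HR1 HR2]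
    /andP[SY1 SY2] flow.
  have flow1 x y : x \in XA -> flows S1 x y -> y \in St -> y \in XA.
    by move=> xXA xy; apply: flow xXA _; rewrite /flows has_cat -/(flows S1 x y) xy.
  have flow2 x y : x \in XA -> flows S2 x y -> y \in St -> y \in XA.
    by move=> xXA xy; apply: flow xXA _; rewrite /flows has_cat -/(flows S2 x y) xy orbT.
  (* The abstraction follows the same branch; a variable in the intersection of the two [must_write]
     sets is written on either. *)
  case=> [Hs'|Hs'].
    have [t' [Ht' H1 H2]] := IH1 s t R Y SN1 RN XAY YN Hst HR1 SY1 flow1 Hs'.
    exists t'; split=> //; first by left.
    move=> x xXA; rewrite !inE => xRS; apply: H1 => //.
    by rewrite inE; case/orP: xRS => [->|/andP[->]] //; rewrite orbT.
  have [t' [Ht' H1 H2]] := IH2 s t R Y SN2 RN XAY YN Hst HR2 SY2 flow2 Hs'.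
  exists t'; split=> //; first by right.
  move=> x xXA; rewrite !inE => xRS; apply: H1 => //.
  by rewrite inE; case/orP: xRS => [->|/andP[_ ->]] //; rewrite orbT.
- rewrite /= fsubUset fsub1set => /andP[zN SN] RN XAY YN Hst HR SY flow [d Hs'].
  (* Giving [hat z] the value [d] of [z] makes the states agree on [z], which therefore joins both
     [R] and [Y]. *)
  have [//|||||||//|//|t' [Ht' H1 H2]] :=
    IH [eta s with z |-> d] [eta t with hat z |-> d] (z |` R) (z |` Y).
  + by rewrite fsubUset fsub1set zN.
  + exact: fsubset_trans XAY (fsubsetUr _ _).
  + by rewrite fsubUset fsub1set zN.
  + exact: agree_update.
  + exact: agree_update_scope HR.
  + apply/fsubsetP => x xS; rewrite !inE; case: eqP => //= /eqP xz.
    by have := fsubsetP SY x; rewrite !inE xz; apply.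
  exists t'; split; first by exists d.
    move=> x xXA xRS; apply: H1 => //; move: xRS; rewrite !inE.
    by case: (x == z).
  by move=> y yN; rewrite H2 //= (negPf (yN _ zN)).
Qed.

End Simulation.

(** * From simulation to the refinement obligations *)

Lemma exec_refines {hat : var -> var} {Nm St XA R : {fset var}} {S s s'} :
  {in Nm &, injective hat} -> {in Nm, forall x, hat x \notin Nm} ->
  svars S `<=` Nm -> XA `<=` Nm -> R `<=` XA ->
  {in R, forall x, s x = s (hat x)} ->
  {in sreads S, forall x, x \in XA -> x \in R} ->
  sreads S `<=` St -> XA `<=` R `|` must_write S ->
  (forall x y, x \in XA -> flows S x y -> y \in St -> y \in XA) ->
  exec S s s' ->
  exists t', [/\ exec (srename hat (absS XA S)) s' t',
    {in XA, forall x, t' x = t' (hat x)} & {in Nm, t' =1 s'}].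
Proof.
move=> hat_inj hatN SN XAN RXA Hs HR SSt XAR flow Hs'.
have RN := fsubset_trans RXA XAN.
(* The nested preconditions start the abstract run from [s'], not from [s]. The copies lie outside
   [Nm], so the concrete run has left them unchanged. *)
have [||t' [Ht' H1 H2]] := @exec_absS _ _ hat_inj St XA S s s' s' R XA SN RN
    (fsubset_refl _) XAN _ HR _ flow Hs'.
- move=> x xR; rewrite Hs //; apply: exec_frame Hs' _.
  by apply: contra (hatN _ (fsubsetP RN _ xR)); apply: (fsubsetP SN).
- exact: fsubset_trans SSt (fsubsetUr _ _).
have H2N : {in Nm, t' =1 s'}.
  move=> y yN; apply: H2 => x xN.
  by apply: contraTneq yN => ->; apply: hatN.
exists t'; split=> // x xXA.
by rewrite H1 ?(fsubsetP XAR) // H2N // (fsubsetP XAN).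
Qed.

End Semantics.

Theorem theorem2 (fs rs D : Type) (In : interp fs rs D) (N : finType)
    (M : system fs rs N) (X XA : {fset var}) (hat : var -> var)
    (hM : correct In M)
    (hX : X `<=` states M)
    (hXA : is_abstract_vars M X XA)
    (hinit : initialises XA (init M))
    (hhat : fresh_copy hat M) :
  refined_by In hat (abstraction XA M) M.
Proof.
case: hM => [[_ _ /and5P[initSt _ _ _ _] evSt] Hinit Hev].
case: hXA hhat => _ XASt flow _ [hat_inj hatN].
have XAN : XA `<=` names M.
  by apply: fsubset_trans XASt _; rewrite /names -!fsetUA fsubsetUl.
have invN : {subset fv (Defs.inv M) <= names M}.
  move=> x xI; have := fsubsetP (fv_sub_vars _) _ xI.
  by rewrite !inE => ->; rewrite !orbT.
have initN : svars (init M) `<=` names M.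
  by apply/fsubsetP => x xS; rewrite !inE xS !orbT.
have evN e : svars (event M e) `<=` names M.
  apply/fsubsetP => x xS; rewrite !inE; apply/orP; right.
  by apply/bigfcupP; exists e; rewrite ?mem_enum.
have glue s' t' : sat In s' (Defs.inv M) ->
    {in XA, forall x, t' x = t' (hat x)} -> {in names M, t' =1 s'} ->
    sat In t' (gluing hat (abstraction XA M) M).
  move=> HI HXA HN; apply/sat_gluing; split=> //.
  by apply: (iffRL (sat_ext In (Defs.inv M) _)) HI => x /invN /HN.
case/andP: hinit => /fdisjointP initXA initW.
(* [Hno] says that no abstract run from [s'] ends in the gluing invariant; one run that does refutes
   it. *)
split=> [s|e s [_ /sat_gluing[HI Hs]]]; apply/sat_wp => s' Hs' /sat_wp Hno.
  (* No agreement holds beforehand, so [R] is empty: [initialises] ensures that nothing in [XA] is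
     read and all of it is written. *)
  have [||||t' [Ht' HXA HN]] := exec_refines In hat_inj hatN initN XAN
    (fsub0set XA) _ _ initSt _ _ Hs'.
  - by move=> x; rewrite inE.
  - by move=> x xS xXA; have := initXA _ xS; rewrite xXA.
  - by rewrite fset0U.
  - by move=> x y xXA xy ySt; apply: flow xXA ySt _; left.
  apply: (Hno t' Ht'); apply: glue HXA HN.
  by have /sat_wp := Hinit s; apply.
have /and5P[eSt _ _ _ _] := evSt e.
(* For an event the gluing invariant gives agreement on all of [XA], so [R] is [XA]. *)
have [||t' [Ht' HXA HN]] := exec_refines In hat_inj hatN (evN e) XAN
  (fsubset_refl XA) Hs (fun x _ xXA => xXA) eSt _ _ Hs'.
- exact: fsubsetUl.
- by move=> x y xXA xy ySt; apply: flow xXA ySt _; right; exists e.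
apply: (Hno t' Ht'); apply: glue HXA HN.
by have /sat_wp := Hev e s HI; apply.
Qed.
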